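(* For every even positive integer $k$ and every positive integer $n$, $$S_n(M_k)\le (2.25\,k^2)^n.$$
   Context: Permutations of length $n$ ($n$-permutations) are written in one-line notation $p=p_1p_2\cdots p_n$. Let $k,n$ be positive integers. A permutation $p=p_1\cdots p_n$ avoids the pattern $q=q_1q_2\cdots q_k$ (a permutation of length $k$) if there are no indices $i_1<i_2<\cdots<i_k$ such that for all $a,b$ the inequality $p_{i_a}<p_{i_b}$ holds if and only if $q_a<q_b$ (in particular every $p$ with $n<k$ avoids $q$). $S_n(q)$ denotes the number of permutations of length $n$ that avoid $q$. For $m\ge 1$, $M_{2m}$ denotes the pattern $1\,3\,2\,5\,4\cdots(2m-1)(2m-2)\,2m$ of length $2m$, i.e. the permutation of $\{1,\dots,2m\}$ that fixes $1$ and $2m$ and interchanges $2i$ and $2i+1$ for each $1\le i\le m-1$. Thus $M_2=12$, $M_4=1324$, $M_6=132546$. *)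

(* Defs.v *)
From mathcomp Require Import all_boot all_fingroup zify.

Set Implicit Arguments.
Unset Strict Implicit.
Unset Printing Implicit Defensive.

(* One-line notation with positions and values shifted by one:
   p = p_1 ... p_n is the permutation s : 'S_n with s (i - 1) = p_i - 1. *)
Definition contains (n k : nat) (p : 'S_n) (q : 'S_k) : bool :=
  [exists f : {ffun 'I_k -> 'I_n},
    [forall a : 'I_k, forall b : 'I_k, (a < b) ==> (f a < f b)] &&
    [forall a : 'I_k, forall b : 'I_k, (p (f a) < p (f b)) == (q a < q b)]].

Definition avoids (n k : nat) (p : 'S_n) (q : 'S_k) : bool := ~~ contains p q.

Definition num_avoiding (n k : nat) (q : 'S_k) : nat :=
  #|[set p : 'S_n | avoids p q]|.

(* The exchange of the values 2i and 2i+1 becomes, after the shift by one, the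
   exchange of 2i-1 and 2i, for all i >= 1 with 2i+1 < k.  When k = 2m this
   means 1 <= i <= m - 1, so that 0 and k - 1 are fixed.  For odd k the
   function is still an involution of {0, ..., k-1}, but only even k matters. *)
Definition M_fun (k i : nat) : nat :=
  if odd i then (if i.+2 < k then i.+1 else i)
  else if (0 < i) && (i.+1 < k) then i.-1 else i.

Lemma M_fun_lt (k : nat) (i : 'I_k) : M_fun k i < k.
Proof. by have := ltn_ord i; rewrite /M_fun; do !case: ifP => ?; lia. Qed.

Definition M_ord (k : nat) (i : 'I_k) : 'I_k := Ordinal (M_fun_lt i).

Lemma M_ordK (k : nat) : involutive (@M_ord k).
Proof.
case=> i lt_ik; apply: val_inj; rewrite /= /M_fun.
case: i lt_ik => [|i] //= lt_ik.
case i_odd: (odd i); first case lt_i: (i.+2 < k); last case lt_i: (i.+3 < k).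
all: rewrite /= i_odd /= ?lt_i //.
Qed.

Definition M (k : nat) : 'S_k := perm (inv_inj (@M_ordK k)).

(* Main.v *)
(* M_{2m} is contained in the direct sum of m + 1 copies of 21.  A permutation
   avoiding t + 2 such copies splits greedily into a part avoiding t + 1 copies
   and a part avoiding 2143; hence an M_{2m}-avoider splits into m parts avoiding
   2143.  A 2143-avoider is determined by three colours on its positions and
   values: the entries with a descent above and to the right, and, among the
   others (which avoid 132), the left-to-right minima and the rest; within each
   colour the values are forced one position at a time.  So an M_{2m}-avoider is
   encoded by two words of length n over 3m letters, and (3m)^2 = 2.25 (2m)^2. *)
Require Import Defs.
From mathcomp Require Import all_boot all_order all_algebra all_fingroup.
From mathcomp Require Import zify ring.

Set Implicit Arguments.
Unset Strict Implicit.
Unset Printing Implicit Defensive.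

(** * Stacks of descents and the splitting into classes avoiding 2143 *)

Section Descents.
Variables (n : nat) (p : 'S_n).
Implicit Types (A B : {set 'I_n}) (i j v w t : nat).

(* Some t-fold direct sum of 21 lies within A, at positions < i, with values < v. *)
Fixpoint desc_stack A t i v : bool :=
  if t is t'.+1 then
    [exists a : 'I_n, exists b : 'I_n,
      [&& a \in A, b \in A, a < b, b < i, p b < p a, p a < v
        & desc_stack A t' a (p b)]]
  else true.

Lemma desc_stackSP A t i v :
  reflect (exists a b : 'I_n, [/\ a \in A, b \in A & a < b] /\
             [/\ b < i, p b < p a, p a < v & desc_stack A t a (p b)])
          (desc_stack A t.+1 i v).
Proof.
apply: (iffP existsP) => [[a /existsP[b /and5P[? ? ? ? /and3P[? ? ?]]]]|].
  by exists a, b.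
move=> [a [b [[? ? ?] [? ? ? ?]]]]; exists a; apply/existsP; exists b.
by apply/and5P; split=> //; apply/and3P.
Qed.

(** The inclusion is asked only to the left of [i], where the whole stack lies; this locality is
    what makes [greedy_step] causal. *)
Lemma desc_stack_mono A B t i j v w :
  (forall x : 'I_n, x < i -> x \in A -> x \in B) -> i <= j -> v <= w ->
  desc_stack A t i v -> desc_stack B t j w.
Proof.
elim: t i j v w => // t IH i j v w sAB leij levw /desc_stackSP[a [b]].
move=> [[aA bA ab] [bi ba av st]]; apply/desc_stackSP; exists a, b.
split; split; try lia; [by apply: sAB => //; lia | by apply: sAB |].
by apply: IH st => // x xa; apply: sAB; lia.
Qed.

(** Recursion along positions, phrased as a fixed point: after [k] iterations the positions below
    [k] no longer change, so [n] iterations settle all of them. *)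
Lemma causal_fixpoint (G : {set 'I_n} -> {set 'I_n}) :
  (forall B B' (i : 'I_n), (forall j : 'I_n, j < i -> (j \in B) = (j \in B')) ->
     (i \in G B) = (i \in G B')) ->
  exists B, G B = B.
Proof.
move=> causal; exists (iter n G set0).
suff stab k (i : 'I_n) : i < k -> (i \in iter k.+1 G set0) = (i \in iter k G set0).
  by apply/setP => i; apply: stab.
elim: k i => // k IH i ltik; apply: causal => j ltji; apply: IH; lia.
Qed.

(** One simultaneous update of all positions; a fixed point of it is the outcome of the greedy
    left-to-right choice. *)
Definition greedy_step A t B : {set 'I_n} :=
  [set i in A | [exists j in B, (j < i) && (p j < p i)]
     || [exists a in A :\: B,
          [&& a < i, p i < p a & desc_stack (A :\: B) t a (p i)]]].

Lemma greedy_step_causal A t B B' (i : 'I_n) :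
  (forall j : 'I_n, j < i -> (j \in B) = (j \in B')) ->
  (i \in greedy_step A t B) = (i \in greedy_step A t B').
Proof.
have sub B1 B2 : (forall j : 'I_n, j < i -> (j \in B1) = (j \in B2)) ->
    i \in greedy_step A t B1 -> i \in greedy_step A t B2.
  move=> eqB; rewrite !inE => /andP[-> /orP[|]] /=.
    case/existsP=> j /and3P[jB ji pji]; apply/orP; left.
    by apply/existsP; exists j; rewrite -eqB // jB ji.
  case/existsP=> a /and4P[aAB ai pia st]; apply/orP; right.
  apply/existsP; exists a; rewrite ai pia; move: aAB; rewrite !inE eqB // => ->.
  apply: desc_stack_mono st => // x xa; rewrite !inE eqB //; lia.
by move=> eqB; apply/idP/idP; apply: sub => // j /eqB.
Qed.

(* The merge argument of Claesson, Jelinek and Steingrimsson: reading from left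
   to right, an entry goes to [B] if it lies above and to the right of an
   earlier entry of [B], or if it would complete a stack outside [B]. *)
Lemma desc_stack_split A t :
  ~~ desc_stack A t.+2 n n ->
  exists B, [/\ B \subset A, ~~ desc_stack (A :\: B) t.+1 n n
              & ~~ desc_stack B 2 n n].
Proof.
move=> avA.
have [B fixB] := causal_fixpoint (@greedy_step_causal A t).
have sBA : B \subset A by apply/subsetP => i; rewrite -{1}fixB inE => /andP[].
exists B; split=> //; apply/negP.
  (* The last entry [b] of such a stack completes it, so the greedy rule would have put [b] in
     [B]. *)
  move=> /desc_stackSP[a [b [[aR bR ab] [_ pba _ st]]]].
  have /setDP[bA /negP[]] := bR; rewrite -fixB inE bA.
  by apply/orP; right; apply/existsP; exists a; rewrite aR ab pba.
have seed (x : 'I_n) : x \in B -> exists y a : 'I_n,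
    [/\ y \in A, y <= x & p y <= p x] /\
    [/\ a \in A :\: B, a < y, p y < p a & desc_stack (A :\: B) t a (p y)].
  have [k] := ubnP (nat_of_ord x); elim: k x => // k IH x xk xB.
  move: (xB); rewrite -{1}fixB inE => /andP[xA /orP[]].
    case/existsP=> j /and3P[jB ji pji].
    have [|y [a [[? ? ?] ?]]] := IH j _ jB; first by lia.
    by exists y, a; split=> //; split=> //; lia.
  by case/existsP=> a /and4P[aR ax pxa st]; exists x, a.
move=> /desc_stackSP[c [d [[cB dB cd] [_ pdc _]]]].
move=> /desc_stackSP[b [x [[bB xB bx] [xc pxb pbd _]]]].
have inA := subsetP sBA.
have [y [a [[yA yx pyx] [aR ay pya st]]]] := seed x xB.
have /setDP[aA _] := aR.
have stA : desc_stack A t a (p y).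
  by apply: desc_stack_mono st => // z _; rewrite inE => /andP[].
(* With [c], [d] on top, the middle descent is [a], [y] if [a] lies below [d], and [b], [x] if [a]
   lies above [d] and to the left of [b]. Otherwise [a] is above and to the right of [b], so it
   belongs to [B], which is absurd. *)
apply/negP: avA; rewrite negbK.
apply/desc_stackSP; exists c, d; split; first by split; auto.
split=> //.
case: (ltnP (p a) (p d)) => [pad|pda].
  by apply/desc_stackSP; exists a, y; split; split=> //; lia.
have aNb : nat_of_ord a != b.
  by apply: contraTneq aR => /val_inj ->; rewrite inE bB.
case: (ltnP a b) => [ab|ba].
  apply/desc_stackSP; exists b, x; split; split; auto.
  by apply: desc_stack_mono stA => //; lia.
have /setDP[_ /negP[]] := aR; rewrite -fixB inE aA.
by apply/orP; left; apply/existsP; exists b; rewrite bB; apply/andP; split; lia.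
Qed.

Lemma desc_stack_partition A t :
  ~~ desc_stack A t.+2 n n ->
  exists l : 'I_n -> 'I_t.+1,
    forall s, ~~ desc_stack [set i in A | l i == s] 2 n n.
Proof.
elim: t A => [|t IH] A avA.
  exists (fun=> ord0) => s; apply: contra avA.
  by apply: desc_stack_mono => // x _; rewrite inE => /andP[].
have [B [sBA /IH[l avl] avB]] := desc_stack_split avA.
exists (fun i : 'I_n => if i \in B then ord0 else lift ord0 (l i)) => s.
case: (unliftP ord0 s) => [s' ->|->].
  apply: contra (avl s'); apply: desc_stack_mono => // x _.
  rewrite !inE; case: ifP => _ /andP[-> /=].
    by rewrite (negPf (neq_lift _ _)).
  by rewrite (inj_eq lift_inj).
apply: contra avB; apply: desc_stack_mono => // x _.
by rewrite inE => /andP[_]; case: ifP.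
Qed.

(** * From stacks to occurrences of [M] *)

Lemma desc_stack_embed A t i v (x0 : 'I_n) :
  desc_stack A t i v ->
  exists g : nat -> 'I_n,
    (forall a, a < t.*2 -> g a < i /\ p (g a) < v) /\
    (forall a b, a < b < t.*2 -> g a < g b /\
       (if ~~ odd a && (b == a.+1) then p (g b) < p (g a)
        else p (g a) < p (g b))).
Proof.
elim: t i v => [|t IH] i v; first by exists (fun=> x0); split=> *; lia.
move=> /desc_stackSP[c [d [[_ _ cd] [di pdc pcv /IH[g [gb gm]]]]]].
(* The lower stack fills the first [2t] indices and the topmost descent the next two. *)
exists (fun a => if a < t.*2 then g a else if a == t.*2 then c else d).
split=> [a|a b] ab.
  by case: ifP => [/gb|_]; [lia | case: eqP; lia].
case: (ltnP b t.*2) => bt.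
  have at2 : a < t.*2 by lia.
  by rewrite at2; apply: gm; case/andP: ab => ->.
case: (ltnP a t.*2) => [at2|ta].
  have [? ?] := gb a at2; have -> : ~~ odd a && (b == a.+1) = false by lia.
  by case: eqP => _ /=; lia.
have -> : a = t.*2 by lia.
have -> : b = t.*2.+1 by lia.
by rewrite odd_double !eqxx /= gtn_eqF.
Qed.

(** Deleting the first and the last entry of 2 1 4 3 ... (2m+2) (2m+1) leaves a copy of 1 3 2 5 4
    ... 2m; hence the index shift in [f]. *)
Lemma contains_M m : desc_stack setT m.+1 n n -> contains p (M m.*2).
Proof.
move=> st; have [x0 _] := desc_stackSP _ _ _ _ st.
have [g [_ gm]] := desc_stack_embed x0 st.
pose f := [ffun a : 'I_m.*2 => g a.+1].
have f_mono (a b : 'I_m.*2) : a < b -> f a < f b /\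
    (p (f a) < p (f b)) = (M m.*2 a < M m.*2 b) /\
    (p (f b) < p (f a)) = (M m.*2 b < M m.*2 a).
  move=> ab; have [] := gm a.+1 b.+1; first by have := ltn_ord b; lia.
  rewrite !ffunE => lt_g lt_pg; split=> //.
  have -> : (val (M m.*2 a) < val (M m.*2 b)) = ~~ (odd a && (b == a.+1 :> nat)).
    rewrite !permE /= /M_fun.
    by have := ltn_ord b; do !case: ifP => ?; lia.
  have -> : (val (M m.*2 b) < val (M m.*2 a)) = (odd a && (b == a.+1 :> nat)).
    rewrite !permE /= /M_fun.
    by have := ltn_ord b; do !case: ifP => ?; lia.
  by move: lt_pg; rewrite /= negbK eqSS; case: ifP => _; lia.
apply/existsP; exists f; apply/andP; split.
  by apply/forallP=> a; apply/forallP=> b; apply/implyP=> /f_mono[].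
apply/forallP=> a; apply/forallP=> b; apply/eqP.
have [/f_mono[_ []] //|/f_mono[_ []] //|/val_inj ->] := ltngtP a b.
by rewrite !ltnn.
Qed.

(** * The three colours *)

Definition desc_above A i v :=
  [exists a in A, exists b in A, [&& i < a, a < b, v < p b & p b < p a]].

Lemma desc_aboveP A i v :
  reflect (exists a b : 'I_n, [/\ a \in A, b \in A & i < a] /\
             [/\ a < b, v < p b & p b < p a])
          (desc_above A i v).
Proof.
apply: (iffP existsP) => [[a /andP[aA /existsP[b /and5P[]]]]|].
  by move=> *; exists a, b.
move=> [a [b [[aA bA ia] [ab vb pba]]]]; exists a; rewrite aA.
by apply/existsP; exists b; apply/and5P.
Qed.

Definition dominated A := [set i in A | desc_above A i (p i)].
Definition undominated A := A :\: dominated A.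
Definition lr_min A :=
  [set i in undominated A |
     ~~ [exists j in undominated A, (j < i) && (p j < p i)]].
Definition above_min A i v := [exists a in lr_min A, (a < i) && (p a < v)].

(** If an entry of the descent is itself dominated, there is another descent further up and to the
    right, and this cannot go on forever. Hence the undominated entries alone decide where a
    dominated value may go. *)
Lemma desc_above_undominated A i v :
  desc_above A i v = desc_above (undominated A) i v.
Proof.
apply/idP/idP; last first.
  case/desc_aboveP=> a [b [[/setDP[aA _] /setDP[bA _] ?] ?]].
  by apply/desc_aboveP; exists a, b.
have [k] := ubnP (n - i); elim: k i v => // k IH i v ik.
case/desc_aboveP=> a [b [[aA bA ia] [ab vb pba]]].
have far (x : 'I_n) : i < x -> v < p x -> x \in A -> x \notin undominated A ->
    desc_above (undominated A) i v.
  move=> ix vx xA; rewrite !inE xA !andbT negbK /= => /IH.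
  have := ltn_ord x => ? /(_ ltac:(lia)).
  case/desc_aboveP=> c [d [[? ? ?] [? ? ?]]].
  by apply/desc_aboveP; exists c, d; split; split=> //; lia.
have [aU|aU] := boolP (a \in undominated A); last by apply: far aU => //; lia.
have [bU|bU] := boolP (b \in undominated A); last by apply: far bU => //; lia.
by apply/desc_aboveP; exists a, b.
Qed.

(** Moving down and to the left among undominated entries ends at a left-to-right minimum. This
    gives the [mu] condition for the third colour. *)
Lemma above_min_undominated A (i : 'I_n) :
  i \in undominated A -> i \notin lr_min A -> above_min A i (p i).
Proof.
have [k] := ubnP (nat_of_ord i); elim: k i => // k IH i ik iU.
rewrite inE iU negbK /= => /existsP[j /and3P[jU ji pji]].
have [jm|jm] := boolP (j \in lr_min A).
  by apply/existsP; exists j; rewrite jm ji.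
have /existsP[a /and3P[am aj paj]] := IH j ltac:(lia) jU jm.
by apply/existsP; exists a; rewrite am; apply/andP; split; lia.
Qed.

Definition triple_color A (i : 'I_n) : 'I_3 :=
  if i \in dominated A then inord 0
  else if i \in lr_min A then inord 1 else inord 2.

Lemma triple_color0 A (i : 'I_n) : (triple_color A i == inord 0) = (i \in dominated A).
Proof.
by rewrite /triple_color; do 2?case: ifP => _; rewrite -val_eqE /= !inordK.
Qed.

Lemma triple_color1 A (i : 'I_n) : (triple_color A i == inord 1) = (i \in lr_min A).
Proof.
rewrite /triple_color; case: ifP => [iD|_]; last first.
  by case: ifP => _; rewrite -val_eqE /= !inordK.
by rewrite [in RHS]inE [_ \in undominated _]inE iD -val_eqE /= !inordK.
Qed.

End Descents.

(** * Reconstruction from the colours *)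

(* If [f] and [g] rank positions and values, then the [f]-first position at
   which [p] and [p'] differ must take the [g]-least remaining value that [mu]
   allows there. *)
Lemma matching_unique n (p p' : 'S_n) (P : {set 'I_n}) (f g : 'I_n -> nat)
    (mu : 'I_n -> 'I_n -> bool) :
  injective f -> injective g ->
  (forall v, ((p^-1)%g v \in P) = ((p'^-1)%g v \in P)) ->
  (forall i, i \in P -> mu i (p i)) -> (forall i, i \in P -> mu i (p' i)) ->
  {in P &, forall i j, f i < f j -> g (p j) < g (p i) -> ~~ mu i (p j)} ->
  {in P &, forall i j, f i < f j -> g (p' j) < g (p' i) -> ~~ mu i (p' j)} ->
  {in P, p =1 p'}.
Proof.
move=> f_inj g_inj.
(* One inequality is enough: using it for both orders of [p] and [p'] gives equality by
   antisymmetry. *)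
suff first_le (q q' : 'S_n) (i : 'I_n) :
    (forall v, ((q^-1)%g v \in P) = ((q'^-1)%g v \in P)) ->
    (forall i, i \in P -> mu i (q' i)) ->
    {in P &, forall i j, f i < f j -> g (q j) < g (q i) -> ~~ mu i (q j)} ->
    i \in P -> (forall j, f j < f i -> j \in P -> q j = q' j) ->
    g (q i) <= g (q' i).
  move=> eqV mup mup' avp avp' i.
  have [k] := ubnP (f i); elim: k i => // k IH i ik iP.
  have eq_lt j : f j < f i -> j \in P -> p j = p' j by move=> ji; apply: IH; lia.
  apply: g_inj; apply/eqP; rewrite eqn_leq !first_le // => j ji jP.
  by rewrite eq_lt.
move=> eqV muq' avq iP eq_lt; rewrite leqNgt; apply/negP => lt_g.
(* If [j] comes after [i], the value [q' i] is a smaller one allowed at [i], against [avq]; if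
   before, [q'] repeats a value. *)
set j := (q^-1)%g (q' i); have qj : q j = q' i by rewrite permKV.
have jP : j \in P by rewrite eqV permK.
have [ij|ji|/f_inj ij] := ltngtP (f i) (f j).
- by have := avq i j iP jP ij; rewrite qj muq' // => /(_ lt_g).
- have : q' j = q' i by rewrite -qj eq_lt.
  by move/perm_inj=> ij; rewrite ij ltnn in ji.
- by move: lt_g; rewrite -qj ij ltnn.
Qed.

Lemma rev_rank_inj n : injective (fun i : 'I_n => n - i).
Proof.
move=> i j eq_ij; apply: val_inj => /=.
by have := ltn_ord i; have := ltn_ord j; lia.
Qed.

(** Minima are recovered first, then the other undominated entries, then the dominated ones, each by
    [matching_unique] with a [mu] that depends only on entries already recovered. *)
Lemma triple_color_unique n (p p' : 'S_n) (A : {set 'I_n}) :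
  ~~ desc_stack p A 2 n n -> ~~ desc_stack p' A 2 n n ->
  (forall v, ((p^-1)%g v \in A) = ((p'^-1)%g v \in A)) ->
  {in A, triple_color p A =1 triple_color p' A} ->
  (forall v, (p^-1)%g v \in A ->
     triple_color p A ((p^-1)%g v) = triple_color p' A ((p'^-1)%g v)) ->
  {in A, p =1 p'}.
Proof.
move=> av av' eqA eqc eqcV.
have domA q : dominated q A \subset A.
  by apply/subsetP=> i; rewrite inE => /andP[].
have minA q : lr_min q A \subset A.
  by apply/subsetP=> i; rewrite inE => /andP[/setDP[]].
have eqD : dominated p A = dominated p' A.
  apply/setP=> i; have [iA|iA] := boolP (i \in A).
    by rewrite -!triple_color0 eqc.
  by apply/idP/idP=> /(subsetP (domA _)); rewrite (negPf iA).
have eqM : lr_min p A = lr_min p' A.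
  apply/setP=> i; have [iA|iA] := boolP (i \in A).
    by rewrite -!triple_color1 eqc.
  by apply/idP/idP=> /(subsetP (minA _)); rewrite (negPf iA).
have eqU : undominated p A = undominated p' A by rewrite /undominated eqD.
have eqDV v : ((p^-1)%g v \in dominated p A) = ((p'^-1)%g v \in dominated p A).
  have [vA|vA] := boolP ((p^-1)%g v \in A).
    by rewrite [in RHS]eqD -!triple_color0 eqcV.
  by apply/idP/idP=> /(subsetP (domA _)); rewrite -?eqA (negPf vA).
have eqMV v : ((p^-1)%g v \in lr_min p A) = ((p'^-1)%g v \in lr_min p A).
  have [vA|vA] := boolP ((p^-1)%g v \in A).
    by rewrite [in RHS]eqM -!triple_color1 eqcV.
  by apply/idP/idP=> /(subsetP (minA _)); rewrite -?eqA (negPf vA).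
(* Minima decrease from left to right, so with values ranked downwards every value may be
   allowed. *)
have min_anti (q : 'S_n) : {in lr_min q A &, forall i j : 'I_n,
    i < j -> n - q j < n - q i -> ~~ true}.
  move=> i j; rewrite [i \in _]inE => /andP[iU _]; rewrite inE => /andP[_].
  by move=> /existsPn/(_ i); rewrite iU /= => ? ij ?; lia.
have eq_min : {in lr_min p A, p =1 p'}.
  apply: (@matching_unique _ p p' _ (@nat_of_ord n) _
            (fun _ _ => true) _ (@rev_rank_inj n)) => //.
  - exact: val_inj.
  - by rewrite eqM; apply: min_anti.
have eq_above_min i v : above_min p A i v = above_min p' A i v.
  apply/existsP/existsP=> -[a /and3P[am ai pa]]; exists a.
    by rewrite -eqM am ai -eq_min.
  by rewrite eqM am ai eq_min // eqM.
(* A minimum to the left of [i] and below [q j] would form 132 with [i] and [j], and so would be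
   dominated. *)
have rest_anti (q : 'S_n) : {in undominated q A :\: lr_min q A &,
    forall i j : 'I_n, i < j -> q j < q i -> ~~ above_min q A i (q j)}.
  move=> i j /setDP[/setDP[iA _] _] /setDP[/setDP[jA _] _] ij qji.
  apply/negP=> /existsP[a /and3P[]]; rewrite inE => /andP[/setDP[aA]].
  rewrite inE aA /= => /negP not_dom _ ai qaj; apply: not_dom.
  by apply/desc_aboveP; exists i, j.
have eq_rest : {in undominated p A :\: lr_min p A, p =1 p'}.
  apply: (@matching_unique _ p p' _ (@nat_of_ord n) (@nat_of_ord n)
            (fun i v => above_min p A i v)).
  - exact: val_inj.
  - exact: val_inj.
  - by move=> v; rewrite !in_setD eqMV eqDV eqA.
  - by move=> i /setDP[iU im]; apply: above_min_undominated.
  - move=> i; rewrite eqU eqM eq_above_min => /setDP[iU im].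
    exact: above_min_undominated.
  - exact: rest_anti.
  - move=> i j; rewrite eqU eqM eq_above_min; exact: rest_anti.
have eq_und : {in undominated p A, p =1 p'}.
  move=> i iU; have [/eq_min //|im] := boolP (i \in lr_min p A).
  by apply: eq_rest; apply/setDP.
have eq_desc i v : desc_above p A i v = desc_above p' A i v.
  rewrite desc_above_undominated [RHS]desc_above_undominated -eqU.
  apply/desc_aboveP/desc_aboveP=> -[a [b [[aU bU ia] [ab vb pba]]]]; exists a, b.
    by rewrite -!eq_und.
  by rewrite !eq_und.
(* Here positions are read from right to left and values from the top: the descent [j], [i] with a
   descent above and to its right would be 2143. *)
have dom_anti (q : 'S_n) : ~~ desc_stack q A 2 n n ->
    {in dominated q A &, forall i j : 'I_n,
       n - i < n - j -> n - q j < n - q i -> ~~ desc_above q A i (q j)}.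
  move=> avq i j /(subsetP (domA _)) iA /(subsetP (domA _)) jA ij qij.
  apply: contra avq => /desc_aboveP[a [b [[aA bA ia] [ab jb qba]]]].
  apply/desc_stackSP; exists a, b; split=> //; split=> //.
  by apply/desc_stackSP; exists j, i; split; split=> //; lia.
have eq_dom : {in dominated p A, p =1 p'}.
  apply: (@matching_unique _ p p' _ _ _ (fun i v => desc_above p A i v)
            (@rev_rank_inj n) (@rev_rank_inj n)) => //.
  - by move=> i; rewrite inE => /andP[].
  - by move=> i; rewrite eqD eq_desc inE => /andP[].
  - exact: dom_anti.
  - by move=> i j; rewrite eqD eq_desc; apply: dom_anti.
move=> i iA; have [/eq_dom //|iD] := boolP (i \in dominated p A).
by apply: eq_und; apply/setDP.
Qed.

(** * Encoding by two words, and the count *)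

Section Encoding.
Variables (n t : nat) (level : 'S_n -> 'I_n -> 'I_t.+1).
Implicit Type p : 'S_n.

Definition level_class p s := [set i | level p i == s].

Lemma in_level_class p s i : (i \in level_class p s) = (level p i == s).
Proof. by rewrite inE. Qed.

Definition color p i : 'I_t.+1 * 'I_3 :=
  (level p i, triple_color p (level_class p (level p i)) i).
Definition word := {ffun 'I_n -> 'I_t.+1 * 'I_3}.
Definition position_word p : word := [ffun i => color p i].
Definition value_word p : word := [ffun v => color p ((p^-1)%g v)].
Definition encoding p := (position_word p, value_word p).

Lemma position_wordE p i : position_word p i = color p i.
Proof. by rewrite /position_word ffunE. Qed.

Lemma value_wordE p v : value_word p v = color p ((p^-1)%g v).
Proof. by rewrite /value_word ffunE. Qed.

Lemma color_eq p p' i j : color p i = color p' j ->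
  level p i = level p' j /\
  triple_color p (level_class p (level p i)) i =
    triple_color p' (level_class p' (level p' j)) j.
Proof. by move/pair_equal_spec. Qed.

(** The levels in the two words determine the positions and values of each class, so
    [triple_color_unique] applies class by class. *)
Lemma encoding_inj :
  {in [pred p | [forall s, ~~ desc_stack p (level_class p s) 2 n n]] &,
   injective encoding}.
Proof.
move=> p p' /forallP av /forallP av' /pair_equal_spec[eq_pos eq_val].
have eqc i : color p i = color p' i.
  by rewrite -(position_wordE p) eq_pos position_wordE.
have eqcV v : color p ((p^-1)%g v) = color p' ((p'^-1)%g v).
  by rewrite -(value_wordE p) eq_val value_wordE.
have eql i : level p i = level p' i by have [] := color_eq (eqc i).
have eqlV v : level p ((p^-1)%g v) = level p' ((p'^-1)%g v).
  by have [] := color_eq (eqcV v).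
have eqA s : level_class p s = level_class p' s.
  by apply/setP=> i; rewrite 2!in_level_class eql.
apply/permP=> i; set s := level p i.
have iA : i \in level_class p s by rewrite in_level_class.
apply: triple_color_unique iA; first exact: av.
- by rewrite eqA; exact: av'.
- by move=> v; rewrite [in RHS]eqA 2!in_level_class eqlV.
- move=> j; rewrite in_level_class => /eqP <-; rewrite [in RHS]eqA [in RHS]eql.
  by have [] := color_eq (eqc j).
- move=> v; rewrite in_level_class => /eqP <-; rewrite [in RHS]eqA [in RHS]eqlV.
  by have [] := color_eq (eqcV v).
Qed.

End Encoding.

Lemma num_avoiding_M n t :
  num_avoiding n (M t.+1.*2) <= (3 * t.+1) ^ n * (3 * t.+1) ^ n.
Proof.
have [level levelP] : exists level : 'S_n -> 'I_n -> 'I_t.+1, forall p : 'S_n,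
    ~~ desc_stack p setT t.+2 n n ->
    forall s, ~~ desc_stack p (level_class level p s) 2 n n.
  (* Finite choice gathers the splittings of the separate permutations into one [level]; a
     permutation with a stack of size [t.+2] gets the constant level [ord0]. *)
  apply: (fin_all_exists (P := fun p l => ~~ desc_stack p setT t.+2 n n ->
    forall s, ~~ desc_stack p [set i | l i == s] 2 n n)) => p.
  have [st|/desc_stack_partition[l avl]] := boolP (desc_stack p setT t.+2 n n).
    by exists (fun=> ord0).
  exists l => _ s; apply: contra (avl s).
  by apply: desc_stack_mono => // x _; rewrite !inE.
have -> : (3 * t.+1) ^ n * (3 * t.+1) ^ n = #|{: word n t * word n t}|.
  by rewrite card_prod !card_ffun card_prod !card_ord mulnC.
rewrite /num_avoiding -(card_in_imset (f := encoding level)) ?max_card //.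
have av2 p : p \in [set p : 'S_n | avoids p (M t.+1.*2)] ->
    p \in [pred p | [forall s, ~~ desc_stack p (level_class level p s) 2 n n]].
  rewrite inE => av; apply/forallP; apply: levelP.
  by apply: contra av; apply: contains_M.
by move=> p p' /av2 avp /av2 avp'; apply: encoding_inj.
Qed.

Import GRing.Theory Num.Theory.

Local Open Scope ring_scope.

Theorem corollary4p2 (k n : nat) (k_gt0 : (0 < k)%N) (k_even : ~~ odd k)
    (n_gt0 : (0 < n)%N) :
  (num_avoiding n (M k))%:R <= (9 / 4 * k%:R ^+ 2) ^+ n :> rat.
Proof.
have [t ->] : exists t, k = t.+1.*2 by exists k./2.-1; lia.
(* The square comes from having two words, each over [3 * t.+1] letters. *)
have -> : 9 / 4 * t.+1.*2%:R ^+ 2 = (3 * t.+1)%:R ^+ 2 :> rat.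
  by rewrite -muln2 !natrM; field.
rewrite exprAC -natrX expr2 -natrM ler_nat.
exact: num_avoiding_M.
Qed.
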